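(* Let $n\geq 2$ be an integer. For any fixed $\Lambda\geq\lambda>0$, the function $$\Phi(x)=\frac{x_n^{\frac{\Lambda}{\lambda}}}{|x|^{\frac{\Lambda}{\lambda}(n+1)-1}}$$ satisfies, in the classical (pointwise) sense, $$\mathcal{M}^-_{\lambda,\Lambda}(D^2\Phi)\geq 0\qquad\text{in } \mathbb{R}^n_+ .$$
   Context: $\mathbb{R}^n_+=\{x=(x',x_n)\in\mathbb{R}^{n-1}\times\mathbb{R} : x_n>0\}$. For a real symmetric $n\times n$ matrix $M$ with eigenvalues $\mu_1,\dots,\mu_n$, the Pucci inf-operator is $$\mathcal{M}^-_{\lambda,\Lambda}(M)=\lambda\sum_{\mu_i>0}\mu_i+\Lambda\sum_{\mu_i<0}\mu_i=\inf_{A}\operatorname{tr}(AM),$$ the infimum being over symmetric matrices $A$ with all eigenvalues in $[\lambda,\Lambda]$. *)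

(* Defs.v *)
From HB Require Import structures.
From mathcomp Require Import all_boot all_order all_algebra.
From mathcomp Require Import all_classical all_reals all_analysis.
From mathcomp Require Import polyrcf complex.

Set Implicit Arguments.
Unset Strict Implicit.
Unset Printing Implicit Defensive.

Import Order.TTheory GRing.Theory Num.Theory.
Import numFieldNormedType.Exports.

Local Open Scope classical_set_scope.
Local Open Scope ring_scope.

(* Points of R^n are row vectors.  The library norm of 'rV[R]_n is the sup
   norm: it only provides the topology; |x| is enorm. *)
Definition enorm (R : realType) (n : nat) (x : 'rV[R]_n) : R :=
  Num.sqrt (\sum_(i < n) x 0 i ^+ 2).

Definition ord_last (n : nat) (hn : (2 <= n)%N) : 'I_n :=
  Ordinal (etrans (ltn_predL n) (ltnW hn)).

Definition half_space (R : realType) (n : nat) (hn : (2 <= n)%N) :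
  set 'rV[R]_n := [set x | 0 < x 0 (ord_last hn)].

Definition partial (R : realType) (n : nat) (i : 'I_n) (f : 'rV[R]_n -> R) :
  'rV[R]_n -> R := fun x => 'D_(delta_mx 0 i) f x.

Definition hessian (R : realType) (n : nat) (f : 'rV[R]_n -> R)
    (x : 'rV[R]_n) : 'M[R]_n :=
  \matrix_(i < n, j < n) partial i (partial j f) x.

(* partial is a total function with an unspecified value where the derivative
   does not exist, hence the explicit derivability clauses. *)
Definition C2_on (R : realType) (n : nat) (D : set 'rV[R]_n)
    (f : 'rV[R]_n -> R) : Prop :=
  forall x, D x ->
  [/\ {for x, continuous f},
      forall j, derivable f x (delta_mx 0 j),
      forall j, {for x, continuous (partial j f)},
      forall i j, derivable (partial j f) x (delta_mx 0 i) &
      forall i j, {for x, continuous (partial i (partial j f))}].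

(* The real roots of the characteristic polynomial, repeated according to
   their multiplicity. *)
Definition eigenvalues (R : realType) (n : nat) (M : 'M[R]_n) : seq R :=
  flatten [seq nseq (mup mu (char_poly M)) mu | mu <- rootsR (char_poly M)].

Lemma perm_eigenvalues (R : realType) (n : nat) (M : 'M[R]_n) (s : seq R) :
  char_poly M = \prod_(mu <- s) ('X - mu%:P) -> perm_eq (eigenvalues M) s.
Proof.
move=> Ms; apply/allP => x _ /=; rewrite /eigenvalues.
have M0 : char_poly M != 0 by rewrite monic_neq0 ?char_poly_monic.
have r_uniq : uniq (rootsR (char_poly M)) by rewrite uniq_roots.
have xr : (x \in rootsR (char_poly M)) = root (char_poly M) x.
  by rewrite -(roots_on_rootsR M0) in_itv.
rewrite -[X in _ == X]mu_prod_XsubC -Ms count_flatten -map_comp sumnE big_map.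
under eq_bigr => y _ do rewrite /= count_nseq /=.
have [xr1|xr1] := boolP (x \in rootsR (char_poly M)).
  rewrite (bigD1_seq x) //= eqxx mul1n big1 ?addn0 // => y /negPf yx.
  by rewrite yx mul0n.
rewrite mupNroot -?xr // big_seq big1 // => y yr.
by case: eqP => [yx|_]; rewrite ?mul0n // -yx yr in xr1.
Qed.

Lemma char_poly_similar (F : fieldType) (n : nat) (P N D : 'M[F]_n) :
  P \in unitmx -> N = invmx P *m D *m P -> char_poly N = char_poly D.
Proof.
move=> Punit Neq.
have PN : P *m N = D *m P by rewrite Neq !mulmxA mulmxV // mul1mx.
have : map_mx polyC P *m char_poly_mx N = char_poly_mx D *m map_mx polyC P.
  by rewrite /char_poly_mx mulmxBr mulmxBl scalar_mxC -!map_mxM PN.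
move/(congr1 determinant); rewrite !det_mulmx mulrC.
apply: mulIf; rewrite det_map_mx /= polyC_eq0.
by move: Punit; rewrite unitmxE unitfE.
Qed.

Lemma char_poly_eigenvalues (R : realType) (n : nat) (M : 'M[R]_n) :
  M^T = M -> char_poly M = \prod_(mu <- eigenvalues M) ('X - mu%:P).
Proof.
move=> Msym.
suff [s Ms] : exists s : seq R, char_poly M = \prod_(mu <- s) ('X - mu%:P).
  by rewrite (perm_big _ (perm_eigenvalues Ms)).
pose f := real_complex R.
pose N := map_mx f M.
have Nreal : N \is a mxOver Num.real.
  by apply/mxOverP => i j; rewrite mxE complex_real.
have Nherm : N \is hermsymmx.
  apply: realsym_hermsym => //; apply/is_hermitianmxP.
  by rewrite expr0 scale1r map_mx_id // map_trmx Msym.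
have /hermitian_normalmx/orthomx_spectralP Neq := Nherm.
have /mxOverP dreal := hermitian_spectral_diag_real Nherm.
have Punit := spectral_unit N.
move: (spectralmx N) (spectral_diag N) Neq Punit dreal => P d Neq Punit dreal.
exists [seq complex.Re (d 0 i) | i <- enum 'I_n].
apply: (@map_inj_poly _ _ f); [exact: complexI | exact: rmorph0|].
rewrite map_char_poly rmorph_prod big_map -/N /=.
rewrite (char_poly_similar Punit Neq).
rewrite char_poly_trig ?diag_mx_is_trig // -big_enum /=.
apply: eq_bigr => i _; rewrite rmorphB /= map_polyX map_polyC /= mxE eqxx mulr1n.
by rewrite /f /= RRe_real ?dreal.
Qed.

Definition pucci_inf (R : realType) (n : nat) (lam Lam : R) (M : 'M[R]_n) : R :=
  lam * (\sum_(mu <- eigenvalues M | 0 < mu) mu)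
  + Lam * (\sum_(mu <- eigenvalues M | mu < 0) mu).

Definition Phi (R : realType) (n : nat) (hn : (2 <= n)%N) (lam Lam : R)
    (x : 'rV[R]_n) : R :=
  (x 0 (ord_last hn)) `^ (Lam / lam)
  / (enorm x) `^ (Lam / lam * (n%:R + 1) - 1).

(* Main.v *)
Require Import Defs.
From HB Require Import structures.
From mathcomp Require Import all_boot all_order all_algebra.
From mathcomp Require Import all_classical all_reals all_analysis.
From mathcomp Require Import polyrcf complex.
From mathcomp Require Import ring lra.

(* Put [a = Lam / lam], [b = a (n + 1) - 1], [t = x_n], [q = |x|^2] and let [e] be the
   last basis vector. Up to the factor [t^(a-2) q^(-b/2-2) > 0], the Hessian of
   [Phi] is
     M = a (a - 1) q^2 e^T e - a b t q (e^T x + x^T e) - b t^2 q I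
         + b (b + 2) t^2 x^T x.
   The matrix [S = a q^2 e^T e + b t^2 (q I - x^T x)] is positive semidefinite by
   Cauchy-Schwarz, and so is
     M + S = (a q e - b t x)^T (a q e - b t x) + b t^2 x^T x.
   As [M >= - S], the negative eigenvalues of [M] sum to at least [- tr S], so the
   Pucci operator is at least [lam tr M - (Lam - lam) tr S]. The exponent [b] is
   the one for which [tr M = (a - 1) tr S], which makes this bound vanish. *)

Import Order.TTheory GRing.Theory Num.Theory.
Import numFieldNormedType.Exports.
Local Open Scope classical_set_scope.
Local Open Scope ring_scope.

(** * Spectral lower bound for the Pucci operator *)

Section PucciLowerBound.
Context {R : realType}.

Local Notation re := (map_mx (@complex.Re R)).
Local Notation im := (map_mx (@complex.Im R)).
Local Notation adj A := (map_mx Num.conj (trmx A)).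
Local Notation toC := (map_mx (real_complex R)).

(** The spectral decomposition below lives over [R[i]]. This identity and the next three bring it
    back to real matrices, where positive semidefiniteness is tested on real vectors only. *)
Lemma Re_mulmx_adj (m n p : nat) (A : 'M[R[i]]_(m, n)) (B : 'M[R[i]]_(p, n)) :
  re (A *m adj B) = re A *m (re B)^T + im A *m (im B)^T.
Proof.
apply/matrixP => i j; rewrite !mxE raddf_sum -big_split /=.
apply: eq_bigr => k _; rewrite !mxE; case: (A i k) => a b; case: (B j k) => c d.
by rewrite /= mulrN opprK.
Qed.

Lemma Re_adj_mulmx (m n p : nat) (A : 'M[R[i]]_(n, m)) (B : 'M[R[i]]_(n, p)) :
  re (adj A *m B) = (re A)^T *m re B + (im A)^T *m im B.
Proof.
apply/matrixP => i j; rewrite !mxE raddf_sum -big_split /=.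
apply: eq_bigr => k _; rewrite !mxE; case: (A k i) => a b; case: (B k j) => c d.
by rewrite /= mulNr opprK.
Qed.

Lemma Re_mulmx_real (m n p : nat) (A : 'M[R[i]]_(m, n)) (B : 'M[R]_(n, p)) :
  re (A *m toC B) = re A *m B.
Proof.
apply/matrixP => i j; rewrite !mxE raddf_sum /=.
apply: eq_bigr => k _; rewrite !mxE; case: (A i k) => a b.
by rewrite /= mulr0 subr0.
Qed.

Lemma Im_mulmx_real (m n p : nat) (A : 'M[R[i]]_(m, n)) (B : 'M[R]_(n, p)) :
  im (A *m toC B) = im A *m B.
Proof.
apply/matrixP => i j; rewrite !mxE raddf_sum /=.
apply: eq_bigr => k _; rewrite !mxE; case: (A i k) => a b.
by rewrite /= mulr0 add0r.
Qed.

(* [U + 'i V] is a unitary matrix diagonalizing [M] over [R[i]]. *)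
Lemma real_spectral (n : nat) (M : 'M[R]_n) : M^T = M ->
  exists (U V : 'M[R]_n) (d : 'I_n -> R),
  [/\ perm_eq (eigenvalues M) [seq d i | i <- enum 'I_n],
      forall i, d i = (U *m M *m U^T + V *m M *m V^T) i i &
      U^T *m U + V^T *m V = 1%:M].
Proof.
move=> Msym; pose N := toC M.
have Nreal : N \is a mxOver Num.real.
  by apply/mxOverP => i j; rewrite mxE complex_real.
have Nherm : N \is hermsymmx.
  apply: realsym_hermsym => //; apply/is_hermitianmxP.
  by rewrite expr0 scale1r map_mx_id // map_trmx Msym.
have /hermitian_normalmx/orthomx_spectralP Neq := Nherm.
have /mxOverP dreal := hermitian_spectral_diag_real Nherm.
have Puni := spectral_unitarymx N; have Punit := spectral_unit N.
move: (spectralmx N) (spectral_diag N) Neq Puni Punit dreal.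
move=> P d Neq Puni Punit dreal.
have PV := invmx_unitary Puni.
exists (re P), (im P), (fun i => complex.Re (d 0 i)); split.
- apply: perm_eigenvalues; apply: (@map_inj_poly _ _ (real_complex R)).
  + exact: complexI.
  + exact: rmorph0.
  rewrite map_char_poly rmorph_prod big_map -/N /= (char_poly_similar Punit Neq).
  rewrite char_poly_trig ?diag_mx_is_trig // -big_enum /=; apply: eq_bigr => i _.
  rewrite rmorphB /= map_polyX map_polyC /= mxE eqxx mulr1n.
  by rewrite RRe_real ?dreal.
(* As [M] is real, the right-hand side is the real part of a diagonal entry of [P *m N *m adj P],
   which is [diag_mx d]. *)
- move=> i; rewrite -(Re_mulmx_real _ _ _ _ M) -(Im_mulmx_real _ _ _ _ M).
  rewrite -Re_mulmx_adj -PV -/N Neq.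
  have -> : P *m (invmx P *m diag_mx d *m P) *m invmx P = diag_mx d.
    by rewrite mulmxA mulmxK // mulKVmx.
  by rewrite !mxE eqxx mulr1n.
- rewrite -Re_adj_mulmx -PV mulVmx //.
  by apply/matrixP => i j; rewrite !mxE; case: (i == j).
Qed.

Definition psd {n : nat} (S : 'M[R]_n) : Prop :=
  forall v : 'rV[R]_n, 0 <= (v *m S *m v^T) 0 0.

Lemma diag_quadform (m n : nat) (U : 'M[R]_(m, n)) (S : 'M[R]_n) (i : 'I_m) :
  (U *m S *m U^T) i i = (row i U *m S *m (row i U)^T) 0 0.
Proof. by rewrite -row_mul !mxE; apply: eq_bigr => k _; rewrite !mxE. Qed.

(** Cyclicity of the trace moves [U^T *m U] and [V^T *m V] together, and they add up to the
    identity. *)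
Lemma mxtrace_quadform_sum (n : nat) (U V S : 'M[R]_n) :
  U^T *m U + V^T *m V = 1%:M ->
  \sum_i (U *m S *m U^T + V *m S *m V^T) i i = \tr S.
Proof.
move=> UV1; rewrite -/(\tr _) mxtraceD -!mulmxA.
by rewrite (mxtrace_mulC U) (mxtrace_mulC V) -mxtraceD -!mulmxA -mulmxDr UV1 mulmx1.
Qed.

Lemma sum_eigenvalues (n : nat) (M : 'M[R]_n) : M^T = M ->
  \sum_(mu <- eigenvalues M) mu = \tr M.
Proof.
move=> /real_spectral[U [V [d [Md dE UV1]]]].
rewrite (perm_big _ Md) /= big_map big_enum /= -(mxtrace_quadform_sum _ U V M UV1).
by apply: eq_bigr => i _; exact: dE.
Qed.

(** Let [s i] be the diagonal entry of [S] in the basis that diagonalizes [M]. Testing [M + S] on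
    the basis gives [d i >= - s i], which is used where [d i < 0]; elsewhere [s i >= 0] suffices.
    The [s i] sum to [\tr S]. *)
Lemma sum_neg_eigenvalues_ge (n : nat) (M S : 'M[R]_n) :
  M^T = M -> psd S -> psd (M + S) ->
  - \tr S <= \sum_(mu <- eigenvalues M | mu < 0) mu.
Proof.
move=> /real_spectral[U [V [d [Md dE UV1]]]] S0 MS0.
have psdUV (T : 'M[R]_n) i : psd T -> 0 <= (U *m T *m U^T + V *m T *m V^T) i i.
  by move=> T0; rewrite mxE (diag_quadform _ _ U) (diag_quadform _ _ V) addr_ge0.
rewrite (perm_big _ Md) /= big_map big_enum_cond /=.
rewrite -(mxtrace_quadform_sum _ U V S UV1) -sumrN (bigID (fun i => d i < 0)) /=.
rewrite -[leRHS]addr0 lerD //.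
  apply: ler_sum => i _; rewrite dE -subr_ge0 opprK.
  have := psdUV _ i MS0; rewrite !mulmxDr !mulmxDl !mxE; lra.
by apply: sumr_le0 => i _; rewrite oppr_le0 psdUV.
Qed.

(** With [P] and [N] the sums of the positive and of the negative eigenvalues, the operator equals
    [lam * (P + N) + (Lam - lam) * N], where [P + N = \tr M] and [N >= - \tr S]. *)
Lemma pucci_inf_ge (n : nat) (lam Lam : R) (M S : 'M[R]_n) :
  lam <= Lam -> M^T = M -> psd S -> psd (M + S) ->
  lam * \tr M - (Lam - lam) * \tr S <= pucci_inf lam Lam M.
Proof.
move=> lL Msym S0 MS0; rewrite /pucci_inf -(sum_eigenvalues _ M Msym).
have := sum_neg_eigenvalues_ge _ _ _ Msym S0 MS0.
have -> : \sum_(mu <- eigenvalues M) mu =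
    \sum_(mu <- eigenvalues M | 0 < mu) mu + \sum_(mu <- eigenvalues M | mu < 0) mu.
  rewrite (bigID (fun mu => 0 < mu)) /=; congr (_ + _).
  (* What is neither positive nor negative is zero and drops out of the sum. *)
  rewrite (bigID (fun mu => mu < 0)) /= [X in _ + X]big1 ?addr0.
    by apply: eq_bigl => mu; rewrite -leNgt andb_idl // => /ltW.
  by move=> mu; rewrite -!leNgt => /le_anti.
move: (\tr S) (\sum_(_ <- _ | 0 < _) _) (\sum_(_ <- _ | _ < 0) _).
move=> s P N sN; have : 0 <= (Lam - lam) * (N + s); last by lra.
by rewrite mulr_ge0 ?subr_ge0 -?lerBlDr ?sub0r.
Qed.

End PucciLowerBound.

(** * Directional derivatives of real powers *)

Section DirectionalDerivatives.
Context {R : realType} {V : normedModType R}.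

(** Restriction to a line makes the one-variable chain rule for [powR] applicable to directional
    derivatives. *)
Lemma derive_line (f : V -> R) (x v : V) :
  'D_1 (fun h : R => f (h *: v + x)) 0 = 'D_v f x.
Proof.
rewrite /derive; set g1 := fun h => h^-1 *: _; set g2 := fun h => h^-1 *: _.
suff -> : g1 = g2 by [].
by rewrite funeqE /g1 /g2 => h /=; rewrite addr0 scale0r add0r [_%:A]mulr1.
Qed.

Lemma is_derive_powR_comp (f : V -> R) (x v : V) (df p : R) :
  0 < f x -> is_derive x v f df ->
  is_derive x v (fun y => f y `^ p) (p * f x `^ (p - 1) * df).
Proof.
move=> fx0 [fxv <-]; pose g h := f (h *: v + x).
have g0 : g 0 = f x by rewrite /g scale0r add0r.
have dg : is_derive (0 : R) 1 g ('D_v f x).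
  by split; [exact: (derivable1P f x v).1 | exact: derive_line].
have [d1 d2] : is_derive (0 : R) 1 (fun h => g h `^ p) (p * f x `^ (p - 1) * 'D_v f x).
  have := @is_derive1_powR R p (g 0); rewrite g0 => /(_ fx0) dp.
  by apply: (@is_derive1_comp _ (@powR R ^~ p) g); rewrite ?g0.
split; first exact: (derivable1P _ x v).2.
by rewrite -derive_line.
Qed.

End DirectionalDerivatives.

(** * Derivatives and Hessian of products of powers of [x_n] and [|x|^2] *)

Section HalfSpacePowers.
Context {R : realType} {n : nat} (l : 'I_n).
Implicit Types (x v : 'rV[R]_n) (i j : 'I_n).

Definition sqnorm (x : 'rV[R]_n) : R := \sum_(i < n) x 0 i ^+ 2.

(** On the half-space, derivatives of this family are combinations of its members with coordinates
    as coefficients. Taking powers of [|x|^2] keeps square roots out of the calculus. *)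
Definition pow_prod (p s : R) (x : 'rV[R]_n) : R := x 0 l `^ p * sqnorm x `^ s.

Lemma sqnorm_gt0 x : 0 < x 0 l -> 0 < sqnorm x.
Proof.
move=> xl; rewrite /sqnorm (bigD1 l) //= ltr_pwDl ?exprn_gt0 //.
by apply: sumr_ge0 => i _; rewrite sqr_ge0.
Qed.

Lemma is_derive_coord x v i : is_derive x v (fun y : 'rV[R]_n => y 0 i) (v 0 i).
Proof.
have dc := @differentiable_coord R 1 n x 0 i.
split; first exact: diff_derivable.
rewrite /derive; apply: cvg_lim => //.
(* The difference quotient of a linear form is constant for [h != 0]. *)
apply: cvg_near_cst; near=> h.
rewrite /= !mxE addrK scalerA mulVf ?scale1r //.
near: h; exact: nbhs_dnbhs_neq.
Unshelve. all: by end_near. Qed.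

Lemma is_derive_sqnorm x v : is_derive x v sqnorm (2 * \sum_i x 0 i * v 0 i).
Proof.
rewrite (_ : sqnorm = \sum_(i < n) (fun y : 'rV[R]_n => y 0 i) ^+ 2); last first.
  by apply/funext => y; rewrite fct_sumE; apply: eq_bigr => i _.
rewrite mulr_sumr; apply: is_derive_sum => i.
apply: (is_derive_eq (is_deriveX _ (is_derive_coord x v i))).
by rewrite /= expr1 mulrA.
Qed.

Lemma is_derive_pow_prod (p s : R) x v : 0 < x 0 l ->
  is_derive x v (pow_prod p s)
    (p * v 0 l * pow_prod (p - 1) s x
     + 2 * s * (\sum_i x 0 i * v 0 i) * pow_prod p (s - 1) x).
Proof.
move=> xl; have q0 := sqnorm_gt0 x xl.
have d1 := is_derive_powR_comp _ x v _ p xl (is_derive_coord x v l).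
have d2 := is_derive_powR_comp _ x v _ s q0 (is_derive_sqnorm x v).
apply: (is_derive_eq (is_deriveM d1 d2)).
by rewrite /pow_prod /GRing.scale /=; ring.
Qed.

Lemma continuous_sqnorm : continuous sqnorm.
Proof.
rewrite (_ : sqnorm = \sum_(i < n) (fun y : 'rV[R]_n => y 0 i ^+ 2)); last first.
  by apply/funext => y; rewrite fct_sumE.
apply: (big_ind (fun f : 'rV[R]_n -> R => continuous f)).
- by move=> x; apply: (@cst_continuous _ _ (0 : R)).
- by move=> f g cf cg x; exact: (cvgD (cf x) (cg x)).
- move=> i _ x.
  apply: (@continuous_comp _ _ _ (fun y : 'rV[R]_n => y 0 i) (fun c : R => c ^+ 2) x).
    exact: coord_continuous.
  exact: exprn_continuous.
Qed.

Lemma continuous_pow_prod p s x : 0 < x 0 l -> {for x, continuous (pow_prod p s)}.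
Proof.
move=> xl; have q0 := sqnorm_gt0 x xl.
have pc (r : R) (c : R) : 0 < c -> {for c, continuous (@powR R ^~ r)}.
  move=> c0; apply/differentiable_continuous/derivable1_diffP.
  by case: (@is_derive1_powR R r c c0).
have c1 : {for x, continuous (fun y : 'rV[R]_n => y 0 l `^ p)}.
  apply: (@continuous_comp _ _ _ (fun y : 'rV[R]_n => y 0 l) (@powR R ^~ p) x).
    exact: coord_continuous.
  exact: pc.
have c2 : {for x, continuous (fun y : 'rV[R]_n => sqnorm y `^ s)}.
  apply: (@continuous_comp _ _ _ sqnorm (@powR R ^~ s) x); last exact: pc.
  exact: continuous_sqnorm.
exact: (cvgM c1 c2).
Qed.

Lemma sum_delta x j : \sum_i x 0 i * (delta_mx 0 j : 'rV[R]_n) 0 i = x 0 j.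
Proof.
rewrite (bigD1 j) //= big1 ?addr0 ?mxE ?eqxx ?mulr1 // => i /negPf ij.
by rewrite mxE ij andbF mulr0.
Qed.

Lemma near_half_space x : 0 < x 0 l -> \forall y \near x, 0 < (y : 'rV[R]_n) 0 l.
Proof.
by move=> xl; apply: (@coord_continuous R 1 n 0 l x [set c | 0 < c]); exact: lt_nbhsr.
Qed.

Lemma partial_pow_prod p s x j : 0 < x 0 l ->
  partial j (pow_prod p s) x =
  p * (j == l)%:R * pow_prod (p - 1) s x + 2 * s * x 0 j * pow_prod p (s - 1) x.
Proof.
move=> xl; rewrite /partial.
have [_ ->] := is_derive_pow_prod p s x (delta_mx 0 j) xl.
by rewrite sum_delta mxE eqxx eq_sym.
Qed.

Lemma is_derive_partial_pow_prod p s x i j : 0 < x 0 l ->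
  is_derive x (delta_mx 0 i) (partial j (pow_prod p s))
    (p * (j == l)%:R * ((p - 1) * (i == l)%:R * pow_prod (p - 2) s x
                       + 2 * s * x 0 i * pow_prod (p - 1) (s - 1) x)
     + 2 * s * ((i == j)%:R * pow_prod p (s - 1) x
       + x 0 j * (p * (i == l)%:R * pow_prod (p - 1) (s - 1) x
                  + 2 * (s - 1) * x 0 i * pow_prod p (s - 2) x))).
Proof.
move=> xl.
pose g := (p * (j == l)%:R) \*: pow_prod (p - 1) s +
          (2 * s) \*: ((fun y : 'rV[R]_n => y 0 j) * pow_prod p (s - 1)).
(* The formula for the first partial derivative is known on the half-space only; since that is open,
   it may be differentiated at [x]. *)
apply: (@near_eq_is_derive _ _ _ g).
  near=> y; rewrite partial_pow_prod; last by near: y; exact: near_half_space.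
  by rewrite -[2 * s * _ * _]mulrA.
have d1 := is_derive_pow_prod (p - 1) s x (delta_mx 0 i) xl.
have d2 := is_derive_pow_prod p (s - 1) x (delta_mx 0 i) xl.
have d3 := is_derive_coord x (delta_mx 0 i) j.
apply: is_derive_eq.
rewrite /g !sum_delta !mxE eqxx /= !(eq_sym _ i) /GRing.scale /=.
have -> : p - 1 - 1 = p - 2 by ring.
have -> : s - 1 - 1 = s - 2 by ring.
by ring.
Unshelve. all: by end_near. Qed.

Lemma near_eq_continuous (f g : 'rV[R]_n -> R) x :
  (\near x, f x = g x) -> {for x, continuous g} -> {for x, continuous f}.
Proof.
move=> fg cg; rewrite /prop_for /continuous_at (nbhs_singleton fg).
apply: cvg_trans cg; apply: (@near_eq_cvg _ _ (nbhs x) _ g f).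
by near do apply/esym.
Unshelve. all: by end_near. Qed.

Lemma near_partial_partial_pow_prod p s x i j : 0 < x 0 l ->
  \forall y \near x, partial i (partial j (pow_prod p s)) y =
    p * (j == l)%:R * ((p - 1) * (i == l)%:R * pow_prod (p - 2) s y
                       + 2 * s * (y : 'rV[R]_n) 0 i * pow_prod (p - 1) (s - 1) y)
     + 2 * s * ((i == j)%:R * pow_prod p (s - 1) y
       + y 0 j * (p * (i == l)%:R * pow_prod (p - 1) (s - 1) y
                  + 2 * (s - 1) * y 0 i * pow_prod p (s - 2) y)).
Proof.
move=> xl; near=> y.
have yl : 0 < y 0 l by near: y; exact: near_half_space.
by have [_ <-] := is_derive_partial_pow_prod p s y i j yl.
Unshelve. all: by end_near. Qed.

Lemma C2_on_pow_prod p s : C2_on [set x : 'rV[R]_n | 0 < x 0 l] (pow_prod p s).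
Proof.
move=> x /= xl.
have cp q r := continuous_pow_prod q r x xl.
have cx i : {for x, continuous (fun y : 'rV[R]_n => y 0 i)} by exact: coord_continuous.
have cc (c : R) : {for x, continuous (fun _ : 'rV[R]_n => c)} by exact: cst_continuous.
have cM (f g : 'rV[R]_n -> R) : {for x, continuous f} -> {for x, continuous g} ->
    {for x, continuous (fun y => f y * g y)}.
  by move=> cf cg; exact: (cvgM cf cg).
have cD (f g : 'rV[R]_n -> R) : {for x, continuous f} -> {for x, continuous g} ->
    {for x, continuous (fun y => f y + g y)}.
  by move=> cf cg; exact: (cvgD cf cg).
split.
- exact: cp.
- by move=> j; have [] := is_derive_pow_prod p s x (delta_mx 0 j) xl.
- move=> j; apply: (near_eq_continuous _ (fun y =>
      p * (j == l)%:R * pow_prod (p - 1) s y + 2 * s * y 0 j * pow_prod p (s - 1) y)).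
    near=> y; apply: partial_pow_prod; near: y; exact: near_half_space.
  by apply: (cD); apply: (cM) => //; apply: (cM).
- by move=> i j; have [] := is_derive_partial_pow_prod p s x i j xl.
- move=> i j; apply: (near_eq_continuous _ _ _ (near_partial_partial_pow_prod p s x i j xl)).
  (* With [pow_prod] abstracted, its members are atoms whose continuity is [cp]. *)
  move: pow_prod cp => P cp.
  by do ![exact: cc | exact: cx | exact: cp | apply: (cD) | apply: (cM)].
Unshelve. all: by end_near. Qed.

Lemma powRD1 (c p : R) : 0 < c -> c `^ (p + 1) = c * c `^ p.
Proof. by move=> c0; rewrite powRD ?(gt_eqF c0) ?implybT // powRr1 1?mulrC ?ltW. Qed.

Lemma pow_prodDl p s x : 0 < x 0 l -> pow_prod (p + 1) s x = x 0 l * pow_prod p s x.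
Proof. by move=> xl; rewrite /pow_prod powRD1 // mulrA. Qed.

Lemma pow_prodDr p s x : 0 < x 0 l -> pow_prod p (s + 1) x = sqnorm x * pow_prod p s x.
Proof. by move=> xl; rewrite /pow_prod powRD1 ?sqnorm_gt0 // mulrCA. Qed.

Lemma hessian_pow_prod p s x (e := delta_mx 0 l : 'rV[R]_n)
  (t := x 0 l) (q := sqnorm x) : 0 < t ->
  hessian (pow_prod p s) x = pow_prod (p - 2) (s - 2) x *:
    ((p * (p - 1) * q ^+ 2) *: (e^T *m e)
     + (2 * p * s * t * q) *: (e^T *m x + x^T *m e)
     + (2 * s * t ^+ 2 * q)%:M
     + (4 * s * (s - 1) * t ^+ 2) *: (x^T *m x)).
Proof.
move=> t0; apply/matrixP => i j.
rewrite /hessian mxE (nbhs_singleton (near_partial_partial_pow_prod p s x i j t0)).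
(* All exponents are written upwards from the lowest ones, [p - 2] and [s - 2], so that each term is
   a monomial in [t] and [q] times the common factor. *)
have -> : p - 1 = p - 2 + 1 by ring.
have -> : s - 1 = s - 2 + 1 by ring.
have E1 : pow_prod (p - 2) s x = q ^+ 2 * pow_prod (p - 2) (s - 2) x.
  rewrite {1}(_ : s = s - 2 + 1 + 1); last by ring.
  by rewrite !pow_prodDr // mulrA.
have E2 r : pow_prod p r x = t ^+ 2 * pow_prod (p - 2) r x.
  rewrite {1}(_ : p = p - 2 + 1 + 1); last by ring.
  by rewrite !pow_prodDl // mulrA.
rewrite E1 !E2 pow_prodDl // !pow_prodDr // -/t -/q.
rewrite !mxE !big_ord1 !mxE !eqxx !(andTb, andbT) /= mulr_natr.
rewrite -[_ *+ (i == j)]mulr_natr; ring.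
Qed.

End HalfSpacePowers.

(** * Rank-one matrices and the Cauchy-Schwarz inequality *)

Lemma quadform_outer {R : realType} (n : nat) (u w v : 'rV[R]_n) :
  (v *m (u^T *m w) *m v^T) 0 0 = (v *m u^T) 0 0 * (w *m v^T) 0 0.
Proof. by rewrite mulmxA -(mulmxA (v *m u^T)) mxE big_ord1. Qed.

Lemma mxtrace_outer {R : realType} (n : nat) (u w : 'rV[R]_n) :
  \tr (u^T *m w) = (u *m w^T) 0 0.
Proof.
rewrite mxtrace_mulC /mxtrace big_ord1 !mxE; apply: eq_bigr => i _.
by rewrite !mxE mulrC.
Qed.

Lemma dotmxC {R : realType} (n : nat) (u v : 'rV[R]_n) :
  (u *m v^T) 0 0 = (v *m u^T) 0 0.
Proof. by rewrite -mxtrace_outer mxtrace_mulC /mxtrace big_ord1. Qed.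

Lemma dotmx_ge0 {R : realType} (n : nat) (u : 'rV[R]_n) : 0 <= (u *m u^T) 0 0.
Proof. by rewrite mxE; apply: sumr_ge0 => i _; rewrite mxE -expr2 sqr_ge0. Qed.

Lemma dotmx_CauchySchwarz {R : realType} (n : nat) (u v : 'rV[R]_n) :
  (u *m v^T) 0 0 ^+ 2 <= (u *m u^T) 0 0 * (v *m v^T) 0 0.
Proof.
have h c d : 0 <= c ^+ 2 * (u *m u^T) 0 0 + 2 * c * d * (u *m v^T) 0 0
                  + d ^+ 2 * (v *m v^T) 0 0.
  have := dotmx_ge0 _ (c *: u + d *: v).
  have addE (A B : 'M[R]_1) : (A + B) 0 0 = A 0 0 + B 0 0 by rewrite mxE.
  have scaleE r (A : 'M[R]_1) : (r *: A) 0 0 = r * A 0 0 by rewrite mxE.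
  rewrite linearD !linearZ /= mulmxDl !mulmxDr -!scalemxAl -!scalemxAr.
  rewrite !(addE, scaleE) (dotmxC _ v u); congr (0 <= _); ring.
move: (dotmx_ge0 _ u) (dotmx_ge0 _ v) h.
move: ((u *m u^T) 0 0) ((u *m v^T) 0 0) ((v *m v^T) 0 0) => A B C A0 C0 h.
have [A1|A1] := ltP 0 A.
  (* The vector [B *: u - A *: v] is orthogonal to [u]. *)
  have := h B (- A); rewrite -[leRHS](_ : A * (A * C - B ^+ 2) = _); last by ring.
  by rewrite pmulr_rge0 // subr_ge0.
have {A1}A0 : A = 0 by apply/le_anti; rewrite A1 A0.
rewrite {A}A0 in h *.
have [-> |B0] := eqVneq B 0; first by rewrite mul0r expr0n.
(* For [A = 0] the form is affine in [c] when [d = 1]; this [c] gives it the value [-1], a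
   contradiction. *)
have := h (- (C + 1) / (2 * B)) 1.
have -> : 2 * (- (C + 1) / (2 * B)) * 1 * B = - (C + 1) by field.
by rewrite mulr0 expr1n mul1r; lra.
Qed.

(** * The Pucci inequality for the Hessian of [Phi] *)

Lemma PhiE {R : realType} (n : nat) (hn : (2 <= n)%N) (lam Lam : R) :
  Phi hn lam Lam = pow_prod (ord_last hn) (Lam / lam)
    (- (Lam / lam * (n%:R + 1) - 1) / 2).
Proof.
apply/funext => x; rewrite /Phi /pow_prod /enorm -/(sqnorm x); congr (_ * _).
have q0 : 0 <= sqnorm x by apply: sumr_ge0 => i _; rewrite sqr_ge0.
by rewrite -(powR12_sqrt q0) -powRrM -powRN; congr (_ `^ _); rewrite mulrC mulNr.
Qed.

Lemma pucci_inf_outer_ge0 {R : realType} (n : nat) (lam a g : R) (e x : 'rV[R]_n)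
  (t := (x *m e^T) 0 0) (q := (x *m x^T) 0 0) (b := a * (n%:R + 1) - 1) :
  0 <= lam -> 1 <= a -> 0 <= g -> 0 <= b -> (e *m e^T) 0 0 = 1 ->
  0 <= pucci_inf lam (lam * a) (g *:
    ((a * (a - 1) * q ^+ 2) *: (e^T *m e)
     - (a * b * t * q) *: (e^T *m x + x^T *m e)
     - (b * t ^+ 2 * q)%:M
     + (b * (b + 2) * t ^+ 2) *: (x^T *m x))).
Proof.
move=> lam0 a1 g0 b0 ee.
have addE (A B : 'M[R]_1) : (A + B) 0 0 = A 0 0 + B 0 0 by rewrite mxE.
have subE (A B : 'M[R]_1) : (A - B) 0 0 = A 0 0 - B 0 0 by rewrite !mxE.
have scaleE r (A : 'M[R]_1) : (r *: A) 0 0 = r * A 0 0 by rewrite mxE.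
set M := g *: _.
pose S := g *: ((a * q ^+ 2) *: (e^T *m e)
                + (b * t ^+ 2) *: (q%:M - x^T *m x)).
have MSE : M + S =
    g *: (((a * q) *: e - (b * t) *: x)^T *m ((a * q) *: e - (b * t) *: x)
          + (b * t ^+ 2) *: (x^T *m x)).
  (* Completing the square is an identity in free [b], [t], [q], so their definitions are forgotten
     before [ring]. *)
  rewrite /M /S; move: b t q {ee M S b0 g0 a1 lam0} => b t q.
  apply/matrixP => i j; rewrite !mxE !big_ord1 !mxE.
  case: (i == j); rewrite ?mulr0n ?mulr1n; ring.
have Msym : M^T = M.
  rewrite /M; move: b t q {ee MSE M S b0 g0 a1 lam0} => b t q.
  by apply/matrixP => i j; rewrite !mxE !big_ord1 !mxE (eq_sym j i); ring.
have S_psd : psd S.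
  move=> v; rewrite /S -scalemxAr -scalemxAl scaleE mulr_ge0 //.
  rewrite mulmxDr mulmxDl -!scalemxAr -!scalemxAl mulmxBr mulmxBl mul_mx_scalar.
  rewrite -?scalemxAl !(subE, addE, scaleE) !quadform_outer.
  rewrite (dotmxC _ v e) (dotmxC _ v x) -!expr2 addr_ge0 //.
    by rewrite mulr_ge0 ?sqr_ge0 // mulr_ge0 ?sqr_ge0 // (le_trans ler01).
  (* The form of [q%:M - x^T *m x] at [v] is [|x|^2 |v|^2 - (x . v)^2]. *)
  by rewrite mulr_ge0 ?subr_ge0 ?dotmx_CauchySchwarz // mulr_ge0 ?sqr_ge0.
have MS_psd : psd (M + S).
  move=> v; rewrite MSE -scalemxAr -scalemxAl scaleE mulr_ge0 //.
  rewrite mulmxDr mulmxDl -scalemxAr -scalemxAl addE scaleE !quadform_outer.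
  rewrite [in X in _ + X]dotmxC [in X in X + _]dotmxC -!expr2.
  by rewrite addr_ge0 ?sqr_ge0 // mulr_ge0 ?sqr_ge0 // mulr_ge0 ?sqr_ge0.
(* Comparing the coefficients of [b t^2 q] leaves [b + 2 - 2 a - n = (a - 1)(n - 1)], which is the
   definition of [b]. *)
have trM : \tr M = (a - 1) * \tr S.
  have trN (A : 'M[R]_n) : \tr (- A) = - \tr A by rewrite linearN.
  rewrite /M /S !(mxtraceZ, mxtraceD, trN) !mxtrace_scalar !mxtrace_outer.
  rewrite (dotmxC _ e x) ee -/t -/q -[_ * q *+ n]mulr_natr -[q *+ n]mulr_natr.
  by rewrite /b; ring.
have lLam : lam <= lam * a by rewrite ler_peMr.
have := pucci_inf_ge n _ _ _ _ lLam Msym S_psd MS_psd.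
by rewrite trM; congr (_ <= _); ring.
Qed.

Theorem theorem2p3 (R : realType) (n : nat) (hn : (2 <= n)%N) (lam Lam : R)
    (lam_gt0 : 0 < lam) (le_lam_Lam : lam <= Lam) :
  C2_on (half_space hn) (Phi hn lam Lam) /\
  (forall x : 'rV[R]_n, half_space hn x ->
     0 <= pucci_inf lam Lam (hessian (Phi hn lam Lam) x)).
Proof.
rewrite PhiE; split=> [|x xl]; first exact: C2_on_pow_prod.
set l := ord_last hn; set a := Lam / lam.
have a1 : 1 <= a by rewrite /a ler_pdivlMr // mul1r.
have La : Lam = lam * a by rewrite /a mulrC divfK ?gt_eqF.
set b := a * (n%:R + 1) - 1.
have b0 : 0 < b.
  have : 1 <= (n%:R : R) by rewrite ler1n ltnW.
  by rewrite /b => n1; nra.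
rewrite hessian_pow_prod //; set e := delta_mx 0 l.
have ee : (e *m e^T) 0 0 = 1.
  by rewrite /e trmx_delta mul_delta_mx mxE eqxx.
have ex : x 0 l = (x *m e^T) 0 0.
  by rewrite /e trmx_delta -colE mxE.
have xx : sqnorm x = (x *m x^T) 0 0.
  by rewrite mxE; apply: eq_bigr => i _; rewrite mxE expr2.
have g0 : 0 <= pow_prod l (a - 2) (- b / 2 - 2) x by rewrite mulr_ge0 ?powR_ge0.
have := pucci_inf_outer_ge0 n lam a _ e x (ltW lam_gt0) a1 g0 (ltW b0) ee.
rewrite -La -ex -xx -/b; set g := pow_prod _ _ _ _; congr (0 <= pucci_inf _ _ (_ *: _)).
move: (x 0 l) (sqnorm x) b {La a1 b0 g0 ee ex xx g} => t q b.
(* With [p = a] and [s = - b / 2] the coefficients agree: [2 p s = - a b], [2 s = - b] and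
   [4 s (s - 1) = b (b + 2)]. *)
by apply/matrixP => i j; rewrite !mxE; case: (i == j); rewrite ?mulr0n ?mulr1n; field.
Qed.
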